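(* Let $(Q_{n,\omega},\omega,Q,\mu_n,(a,b))$ be one of the three classical families below, and let $n\geq 1$. Let $t_1<\dots<t_n$ be the zeros of $Q_{n,\omega}$ in $(a,b)$. Then $$\int_a^b |Q_{n,\omega}(t)|\,\omega(t)\,dt = 2\,\frac{\mu_{n-1}}{|\mu_n|}\sum_{j=1}^{n}(-1)^{j+1}\,\omega(t_j)\,Q(t_j)\,Q_{n-1,\omega Q}(t_j).$$
   Context: The classical orthogonal polynomials are given by Rodrigues' formula $Q_{n,\omega}(t)=\frac{1}{\omega(t)\mu_n}\frac{d^n}{dt^n}(\omega Q^n)(t)$, $t\in(a,b)$, for the following data: (Laguerre) $Q_{n,\omega}=L_n^{(\alpha)}$, $\mu_n=n!$, $\omega(t)=t^{\alpha}e^{-t}$, $Q(t)=t$, $(a,b)=(0,\infty)$, with $\alpha>-1$; (Hermite) $Q_{n,\omega}=H_n$, $\mu_n=(-1)^n$, $\omega(t)=e^{-t^2}$, $Q(t)=1$, $(a,b)=(-\infty,\infty)$; (Jacobi) $Q_{n,\omega}=P_n^{(\alpha,\beta)}$, $\mu_n=(-1)^n2^nn!$, $\omega(t)=(1-t)^{\alpha}(1+t)^{\beta}$, $Q(t)=1-t^2$, $(a,b)=(-1,1)$, with $\alpha,\beta>-1$. Correspondingly, $Q_{n-1,\omega Q}$ denotes the function given by the same Rodrigues formula with weight $\omega Q$ in place of $\omega$, i.e. $Q_{n-1,\omega Q}(t)=\frac{1}{\omega(t)Q(t)\mu_{n-1}}\frac{d^{n-1}}{dt^{n-1}}(\omega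 Q\cdot Q^{n-1})(t)$. The zeros of $Q_{n,\omega}$ are real, simple and lie in $(a,b)$. *)

(* Defs.v *)
From Stdlib Require Import Reals Factorial.
From Coquelicot Require Import Coquelicot.
Open Scope R_scope.

Definition rodrigues (w Qf : R -> R) (mu : R) (n : nat) (t : R) : R :=
  / (w t * mu) * Derive_n (fun s => w s * Qf s ^ n) n t.

(* The identity of Theorem 1.1 for the data (w, Q, mu_., (a,b)), degree n.
   Fa / Fb are the filters describing the endpoints a / b of the improper
   integral \int_a^b (at_right a for finite a, Rbar_locally m_infty for a=-oo,
   at_left b for finite b, Rbar_locally p_infty for b=+oo). *)
Definition L1_identity (w Qf : R -> R) (mu : nat -> R) (a b : Rbar)
  (Fa Fb : (R -> Prop) -> Prop) {FFa : Filter Fa} {FFb : Filter Fb}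
  (n : nat) : Prop :=
  forall t : nat -> R,
    (forall j : nat, (1 <= j < n)%nat -> t j < t (S j)) ->
    (forall x : R, Rbar_lt a x -> Rbar_lt x b ->
        (rodrigues w Qf (mu n) n x = 0 <->
         exists j : nat, (1 <= j <= n)%nat /\ x = t j)) ->
    is_RInt_gen (fun x => Rabs (rodrigues w Qf (mu n) n x) * w x) Fa Fb
      (2 * (mu (n - 1)%nat / Rabs (mu n)) *
       sum_n_m (fun j => (-1) ^ (j + 1) * w (t j) * Qf (t j) *
                 rodrigues (fun s => w s * Qf s) Qf (mu (n - 1)%nat) (n - 1) (t j))
               1 n).

Definition lag_w (al : R) (t : R) : R := Rpower t al * exp (- t).
Definition lag_Q (t : R) : R := t.
Definition lag_mu (n : nat) : R := INR (fact n).

Definition her_w (t : R) : R := exp (- t ^ 2).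
Definition her_Q (t : R) : R := 1.
Definition her_mu (n : nat) : R := (-1) ^ n.

Definition jac_w (al be : R) (t : R) : R := Rpower (1 - t) al * Rpower (1 + t) be.
Definition jac_Q (t : R) : R := 1 - t ^ 2.
Definition jac_mu (n : nat) : R := (-1) ^ n * 2 ^ n * INR (fact n).

(* Main.v *)
(** Let [g = w Q^n] and [F = g^(n-1)], so that the integrand is [|F'| / |mu_n|].
    Since [w' = w P / Q] with [P] a polynomial, [g^(k) = w Q^(n-k) p_k] with [p_k] a
    polynomial, and this tends to [0] at both ends of [(a,b)] for [k < n].  The mean value
    theorem then shows by induction on [k] that [g^(k)] takes values of alternating
    signs, the first one positive, at [k+1] increasing points.  For [k = n] this
    locates one zero [t_j] of [F'] in each gap and gives the sign [(-1)^j] of [F'] on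
    [(t_j, t_(j+1))], without using that the zeros are simple; integrating [F'] piecewise,
    the boundary terms of [F] vanish and the sum telescopes. *)

Require Import Defs.
From Stdlib Require Import Reals Ranalysis5 Lra Lia.
From Stdlib Require Import IndefiniteDescription.
From Coquelicot Require Import Coquelicot.
Open Scope R_scope.

(** * Intervals with extended endpoints, and limits along filters *)

Definition inside (a b : Rbar) (x : R) : Prop := Rbar_lt a x /\ Rbar_lt x b.

Lemma inside_locally (a b : Rbar) (x : R) :
  inside a b x -> locally x (inside a b).
Proof.
  intros [Ha Hb]. apply filter_and.
  - exact (open_Rbar_gt a x Ha).
  - exact (open_Rbar_lt b x Hb).
Qed.

Lemma inside_between (a b : Rbar) (x y z : R) :
  inside a b x -> inside a b y -> x <= z <= y -> inside a b z.
Proof.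
  intros [Ha _] [_ Hb] Hz; split.
  - apply Rbar_lt_le_trans with x; [exact Ha | simpl; lra].
  - apply Rbar_le_lt_trans with y; [simpl; lra | exact Hb].
Qed.

(** The bound [i <= n] is moved into the relation, which becomes total with [x0] as value beyond
    [n]; functional choice then applies. *)
Lemma bounded_choice {A : Type} (x0 : A) (n : nat) (P : nat -> A -> Prop) :
  (forall i, (i <= n)%nat -> exists x, P i x) ->
  exists f : nat -> A, forall i, (i <= n)%nat -> P i (f i).
Proof.
  intros H.
  apply (functional_choice (fun i x => (i <= n)%nat -> P i x)).
  intros i. destruct (Compare_dec.le_dec i n) as [Hi | Hi].
  - destruct (H i Hi) as [x Hx]. now exists x.
  - now exists x0.
Qed.

Lemma pow_m1_neq0 (k : nat) : (-1) ^ k <> 0.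
Proof. apply pow_nonzero; lra. Qed.

Lemma filterlim_Rplus {T : Type} (F : (T -> Prop) -> Prop) {FF : Filter F}
  (f g : T -> R) (x y : R) :
  filterlim f F (locally x) -> filterlim g F (locally y) ->
  filterlim (fun z => f z + g z) F (locally (x + y)).
Proof.
  intros Hf Hg. eapply filterlim_comp_2; [exact Hf | exact Hg | exact (filterlim_plus x y)].
Qed.

Lemma filterlim_Rmult {T : Type} (F : (T -> Prop) -> Prop) {FF : Filter F}
  (f g : T -> R) (x y : R) :
  filterlim f F (locally x) -> filterlim g F (locally y) ->
  filterlim (fun z => f z * g z) F (locally (x * y)).
Proof.
  intros Hf Hg. eapply filterlim_comp_2;
    [exact Hf | exact Hg | exact (filterlim_mult (K := R_AbsRing) x y)].
Qed.

Lemma filterlim_0_lt {T : Type} (F : (T -> Prop) -> Prop) {FF : Filter F}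
  (f : T -> R) (e : R) :
  filterlim f F (locally 0) -> 0 < e -> F (fun x => f x < e).
Proof.
  intros H He. apply (H (fun y => y < e)), (open_lt e), He.
Qed.

(** * Alternating signs of the successive derivatives *)

(** What the argument needs of a filter at the left end, in a form common to finite and infinite
    endpoints. *)
Definition reaches_left (F : (R -> Prop) -> Prop) (I : R -> Prop) : Prop :=
  forall c, I c -> F (fun x => I x /\ x < c).

Definition reaches_right (F : (R -> Prop) -> Prop) (I : R -> Prop) : Prop :=
  forall c, I c -> F (fun x => I x /\ c < x).

(* One more alternation per derivative: the mean value theorem is applied between
   consecutive points, and between the extreme points and the two ends, where [f]
   tends to zero. *)
Lemma alternation_derive (a b : Rbar) (Fa Fb : (R -> Prop) -> Prop)
  {FFa : ProperFilter Fa} {FFb : ProperFilter Fb} (f df : R -> R) (k : nat) :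
  reaches_left Fa (inside a b) -> reaches_right Fb (inside a b) ->
  (forall x, inside a b x -> is_derive f x (df x)) ->
  filterlim f Fa (locally 0) -> filterlim f Fb (locally 0) ->
  (exists s : nat -> R,
     (forall i, (i <= k)%nat -> inside a b (s i) /\ 0 < (-1) ^ i * f (s i)) /\
     (forall i, (i < k)%nat -> s i < s (S i))) ->
  exists s : nat -> R,
     (forall i, (i <= S k)%nat -> inside a b (s i) /\ 0 < (-1) ^ i * df (s i)) /\
     (forall i, (i < S k)%nat -> s i < s (S i)).
Proof.
  intros HFa HFb Hdf La Lb [s [Hs Hinc]].
  destruct (Hs 0%nat ltac:(lia)) as [I0 P0]. simpl in P0.
  destruct (Hs k ltac:(lia)) as [Ik Pk].
  (* Near the left end [f] is below the positive value [f (s 0)], so its increment from [u] to [s 0]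
     is positive. *)
  destruct (filter_ex (F := Fa) _ (filter_and _ _ (HFa _ I0)
     (filterlim_0_lt Fa f (f (s 0%nat)) La ltac:(lra)))) as [u [[Iu us] fu]].
  assert (Lb' : filterlim (fun x => (-1) ^ k * f x) Fb (locally 0)).
  { replace 0 with ((-1) ^ k * 0) by ring.
    apply (filterlim_Rmult Fb); [apply filterlim_const | exact Lb]. }
  destruct (filter_ex (F := Fb) _ (filter_and _ _ (HFb _ Ik)
     (filterlim_0_lt Fb (fun x => (-1) ^ k * f x) _ Lb' Pk))) as [v [[Iv vs] fv]].
  (* The points [u, s 0, ..., s k, v] bound [k + 2] gaps, and the increment of [f] over gap [i] has
     the sign of [(-1) ^ i]. *)
  set (r := fun i : nat => match i with
                   | O => u
                   | S i => if Compare_dec.le_dec i k then s i else v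
                   end).
  assert (Hr : forall i, (i <= S k)%nat ->
     inside a b (r i) /\ inside a b (r (S i)) /\ r i < r (S i) /\
     0 < (-1) ^ i * (f (r (S i)) - f (r i))).
  { intros [|i] Hi; simpl.
    - repeat split; try apply Iu; try apply I0; lra.
    - destruct (Compare_dec.le_dec i k) as [H1 | H1]; [|lia].
      destruct (Hs i H1) as [Ii Pi].
      destruct (Compare_dec.le_dec (S i) k) as [H2 | H2].
      + destruct (Hs (S i) H2) as [Ii' Pi']. simpl in Pi'.
        split; [exact Ii | split; [exact Ii' | split; [apply Hinc; lia | lra]]].
      + assert (i = k) by lia; subst i.
        split; [exact Ii | split; [exact Iv | split; [exact vs | lra]]]. }
  destruct (bounded_choice 0 (S k)
    (fun i c => r i < c < r (S i) /\ 0 < (-1) ^ i * df c)) as [c Hc].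
  { intros i Hi. destruct (Hr i Hi) as [I1 [I2 [Hlt Hpos]]].
    destruct (MVT_cor2 f df (r i) (r (S i)) Hlt) as [c [Ec Hc]].
    { intros x Hx. apply is_derive_Reals, Hdf. now apply inside_between with (r i) (r (S i)). }
    exists c; split; [exact Hc|].
    rewrite Ec, <- Rmult_assoc in Hpos. nra. }
  exists c; split.
  - intros i Hi. destruct (Hr i Hi) as [I1 [I2 _]]. destruct (Hc i Hi) as [Hb Hp].
    split; [|exact Hp]. apply inside_between with (r i) (r (S i)); lra || assumption.
  - intros i Hi. destruct (Hc i ltac:(lia)) as [H1 _].
    destruct (Hc (S i) ltac:(lia)) as [H2 _]. lra.
Qed.

(** The induction starts from the single point [x0]. Limits are asked for orders below [n], since
    order [n] arises as the derivative in the last step. *)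
Lemma alternation_Derive_n (a b : Rbar) (Fa Fb : (R -> Prop) -> Prop)
  {FFa : ProperFilter Fa} {FFb : ProperFilter Fb} (g : R -> R) (n : nat) (x0 : R) :
  reaches_left Fa (inside a b) -> reaches_right Fb (inside a b) ->
  inside a b x0 -> 0 < g x0 ->
  (forall k x, (k < n)%nat -> inside a b x -> ex_derive (Derive_n g k) x) ->
  (forall k, (k < n)%nat -> filterlim (Derive_n g k) Fa (locally 0)) ->
  (forall k, (k < n)%nat -> filterlim (Derive_n g k) Fb (locally 0)) ->
  exists s : nat -> R,
     (forall i, (i <= n)%nat -> inside a b (s i) /\ 0 < (-1) ^ i * Derive_n g n (s i)) /\
     (forall i, (i < n)%nat -> s i < s (S i)).
Proof.
  intros HFa HFb Ix0 Hg Hd La Lb.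
  assert (H : forall k, (k <= n)%nat -> exists s : nat -> R,
     (forall i, (i <= k)%nat -> inside a b (s i) /\ 0 < (-1) ^ i * Derive_n g k (s i)) /\
     (forall i, (i < k)%nat -> s i < s (S i))).
  { induction k as [|k IH]; intros Hk.
    - exists (fun _ => x0); split; [|lia].
      intros i Hi. replace i with 0%nat by lia. simpl. split; [exact Ix0 | lra].
    - apply (alternation_derive a b Fa Fb (Derive_n g k)); auto with arith.
      intros x Hx. exact (Derive_correct _ _ (Hd k x Hk Hx)). }
  now apply H.
Qed.

(** * Zeros and signs between points of alternation *)

Lemma sign_change_zero (h : R -> R) (x y : R) (k : nat) :
  x < y -> (forall z, x <= z <= y -> continuous h z) ->
  0 < (-1) ^ k * h x -> (-1) ^ k * h y < 0 ->
  exists z, x < z < y /\ h z = 0.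
Proof.
  intros Hxy Hc Hx Hy.
  (* [IVT_interv] wants a negative value on the left and a positive one on the right, hence the
     change of sign. *)
  destruct (IVT_interv (fun z => - ((-1) ^ k * h z)) x y) as [z [Hz Ez]]; try lra.
  - intros z Hz. apply continuity_pt_filterlim.
    apply (continuous_opp (fun z => (-1) ^ k * h z)).
    apply (continuous_scal_r ((-1) ^ k) h). now apply Hc.
  - assert (Ez' : h z = 0).
    { destruct (Rmult_integral ((-1) ^ k) (h z) ltac:(lra)) as [H | H]; [|exact H].
      now destruct (pow_m1_neq0 k). }
    exists z; split; [|exact Ez'].
    destruct (Req_dec z x) as [-> | Nx]; [rewrite Ez' in Hx; lra|].
    destruct (Req_dec z y) as [-> | Ny]; [rewrite Ez' in Hy; lra|]. lra.
Qed.

Lemma sign_constant (h : R -> R) (I : R -> Prop) (k : nat) (s : R) :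
  (forall x y z, I x -> I y -> x <= z <= y -> I z) ->
  (forall x, I x -> continuous h x) -> (forall x, I x -> h x <> 0) ->
  I s -> 0 < (-1) ^ k * h s -> forall x, I x -> 0 < (-1) ^ k * h x.
Proof.
  intros Hcvx Hc Hnz Is Hs x Ix.
  destruct (Rlt_le_dec 0 ((-1) ^ k * h x)) as [H | H]; [exact H | exfalso].
  assert (Hx : (-1) ^ k * h x < 0).
  { destruct H as [H | H]; [exact H|]. exfalso.
    destruct (Rmult_integral _ _ H) as [H' | H'];
      [exact (pow_m1_neq0 k H') | exact (Hnz x Ix H')]. }
  destruct (Rtotal_order s x) as [L | [-> | L]]; [| lra |].
  - destruct (sign_change_zero h s x k L) as [z [Hz Ez]]; try assumption.
    + intros z Hz. apply Hc, (Hcvx s x); assumption.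
    + apply (Hnz z); [apply (Hcvx s x); lra || assumption | exact Ez].
  (* Now [x] is the left point, and the sign of [h x] is opposite to that of [(-1) ^ k]: hence the
     exponent [S k]. *)
  - destruct (sign_change_zero h x s (S k) L) as [z [Hz Ez]]; simpl; try lra.
    + intros z Hz. apply Hc, (Hcvx x s); assumption.
    + apply (Hnz z); [apply (Hcvx x s); lra || assumption | exact Ez].
Qed.

Lemma increasing_upto (t : nat -> R) (n : nat) :
  (forall j, (1 <= j < n)%nat -> t j < t (S j)) ->
  forall i j, (1 <= i)%nat -> (i < j)%nat -> (j <= n)%nat -> t i < t j.
Proof.
  intros Ht i j Hi Hij. induction Hij as [|j Hij IH]; intros Hj.
  - apply Ht; lia.
  - apply Rlt_trans with (t j); [apply IH; lia | apply Ht; lia].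
Qed.

(** Strict growth upwards from [0] gives [i <= f i]; going down from [n], where [f n <= n], it gives
    [f i <= i]. *)
Lemma increasing_selfmap_id (f : nat -> nat) (n : nat) :
  (forall i, (i <= n)%nat -> (f i <= n)%nat) ->
  (forall i, (i < n)%nat -> (f i < f (S i))%nat) ->
  forall i, (i <= n)%nat -> f i = i.
Proof.
  intros Hle Hinc.
  assert (H1 : forall i, (i <= n)%nat -> (i <= f i)%nat).
  { induction i as [|i IH]; intros Hi; [lia|]. specialize (Hinc i Hi).
    specialize (IH ltac:(lia)). lia. }
  assert (H2 : forall d, (d <= n)%nat -> (f (n - d) <= n - d)%nat).
  { induction d as [|d IH]; intros Hd.
    - rewrite PeanoNat.Nat.sub_0_r. now apply Hle.
    - specialize (Hinc (n - S d)%nat ltac:(lia)).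
      replace (S (n - S d)) with (n - d)%nat in Hinc by lia.
      specialize (IH ltac:(lia)). lia. }
  intros i Hi. specialize (H1 i Hi). specialize (H2 (n - i)%nat ltac:(lia)).
  replace (n - (n - i))%nat with i in H2 by lia. lia.
Qed.

(* The [n] sign changes give [n] zeros in increasing order among the [n] numbers
   [t j], so the two sequences coincide. *)
Lemma zeros_interlace (a b : Rbar) (h : R -> R) (n : nat) (s t : nat -> R) :
  (forall x, inside a b x -> continuous h x) ->
  (forall i, (i <= n)%nat -> inside a b (s i) /\ 0 < (-1) ^ i * h (s i)) ->
  (forall i, (i < n)%nat -> s i < s (S i)) ->
  (forall j, (1 <= j < n)%nat -> t j < t (S j)) ->
  (forall x, inside a b x -> h x = 0 -> exists j, (1 <= j <= n)%nat /\ x = t j) ->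
  forall j, (1 <= j <= n)%nat -> s (j - 1)%nat < t j < s j.
Proof.
  intros Hc Hs Hinc Ht Hz.
  destruct n as [|n]; [lia|].
  (* There are now [S n] zeros, and the one found in gap [i] is [t (S (f i))]; the shift makes [f] a
     map of [0, ..., n] into itself. *)
  destruct (bounded_choice 0%nat n
    (fun i j => (j <= n)%nat /\ s i < t (S j) < s (S i))) as [f Hf].
  { intros i Hi.
    destruct (Hs i ltac:(lia)) as [I1 P1]. destruct (Hs (S i) ltac:(lia)) as [I2 P2].
    destruct (sign_change_zero h (s i) (s (S i)) i) as [z [Hz1 Hz2]].
    - apply Hinc; lia.
    - intros z Hz'. apply Hc. now apply inside_between with (s i) (s (S i)).
    - exact P1.
    - simpl in P2; lra.
    - destruct (Hz z) as [j [Hj Ej]]; [|exact Hz2|].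
      + apply inside_between with (s i) (s (S i)); try assumption; lra.
      + exists (j - 1)%nat. replace (S (j - 1)) with j by lia.
        rewrite <- Ej. split; [lia | exact Hz1]. }
  assert (Hid : forall i, (i <= n)%nat -> f i = i).
  { apply increasing_selfmap_id.
    - intros i Hi. apply Hf, Hi.
    - intros i Hi. destruct (Hf i ltac:(lia)) as [B1 L1].
      destruct (Hf (S i) ltac:(lia)) as [B2 L2].
      (* Equal indices would put one zero in two disjoint gaps; reversed ones would contradict the
         growth of [t]. *)
      destruct (PeanoNat.Nat.lt_trichotomy (f i) (f (S i))) as [H | [H | H]]; [exact H | |].
      + rewrite H in L1; lra.
      + assert (t (S (f (S i))) < t (S (f i)))
          by (apply (increasing_upto t (S n) Ht); lia).
        lra. }
  intros j Hj. destruct j as [|j]; [lia|].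
  destruct (Hf j ltac:(lia)) as [_ H]. rewrite (Hid j) in H by lia.
  now replace (S j - 1)%nat with j by lia.
Qed.

(** * Integral of the absolute value of a derivative *)

(** Inside the interval [|f|] is [(-1) ^ k * f], with primitive [(-1) ^ k * F]. The sign is asked on
    the open interval because [f] may vanish at its ends. *)
Lemma is_RInt_abs_derive_const_sign (F f : R -> R) (u v : R) (k : nat) :
  u <= v ->
  (forall x, u <= x <= v -> is_derive F x (f x)) ->
  (forall x, u <= x <= v -> continuous f x) ->
  (forall x, u < x < v -> 0 < (-1) ^ k * f x) ->
  is_RInt (fun x => Rabs (f x)) u v ((-1) ^ k * (F v - F u)).
Proof.
  intros Huv HF Hc Hp.
  apply (is_RInt_ext (fun x => scal ((-1) ^ k) (f x))).
  - intros x. rewrite Rmin_left, Rmax_right by exact Huv. intros Hx.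
    change (scal ((-1) ^ k) (f x)) with ((-1) ^ k * f x).
    rewrite <- (Rabs_pos_eq ((-1) ^ k * f x)) by (specialize (Hp x Hx); lra).
    rewrite Rabs_mult, pow_1_abs. apply Rmult_1_l.
  - apply (is_RInt_scal f u v ((-1) ^ k) (F v - F u)).
    apply (is_RInt_derive F f); rewrite Rmin_left, Rmax_right by exact Huv; assumption.
Qed.

(** Cut at the zeros. The piece ending at [t j] contributes [(-1) ^ (j - 1) * F (t j)] and the piece
    starting there [- (-1) ^ j * F (t j)]: the two agree, which gives the factor 2. *)
Lemma is_RInt_abs_derive (a b : Rbar) (F f : R -> R) (n : nat) (s t : nat -> R) (u v : R) :
  (1 <= n)%nat ->
  (forall x, inside a b x -> is_derive F x (f x)) ->
  (forall x, inside a b x -> continuous f x) ->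
  (forall i, (i <= n)%nat -> inside a b (s i) /\ 0 < (-1) ^ i * f (s i)) ->
  (forall j, (1 <= j <= n)%nat -> s (j - 1)%nat < t j < s j) ->
  (forall x, inside a b x -> f x = 0 -> exists j, (1 <= j <= n)%nat /\ x = t j) ->
  inside a b u -> inside a b v -> u < s 0%nat -> s n < v ->
  is_RInt (fun x => Rabs (f x)) u v
    (- F u + 2 * sum_n_m (fun j => (-1) ^ (j + 1) * F (t j)) 1 n + (-1) ^ n * F v).
Proof.
  intros Hn HF Hc Hs Hst Hz Iu Iv us vs.
  assert (Ht : forall j, (1 <= j < n)%nat -> t j < t (S j)).
  { intros j Hj. destruct (Hst j ltac:(lia)). destruct (Hst (S j) ltac:(lia)) as [H1 _].
    replace (S j - 1)%nat with j in H1 by lia. lra. }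
  pose proof (increasing_upto t n Ht) as Hmono.
  assert (It : forall j, (1 <= j <= n)%nat -> inside a b (t j)).
  { intros j Hj. apply inside_between with (s (j - 1)%nat) (s j);
      [apply Hs; lia | apply Hs; lia | specialize (Hst j Hj); lra]. }
  (* Breakpoints [u, t 1, ..., t n, v], so that [p i] and [p (S i)] enclose [s i]. *)
  set (p := fun i : nat => match i with
       | O => u
       | S _ => if Compare_dec.le_dec i n then t i else v end).
  assert (pt : forall j, (1 <= j <= n)%nat -> p j = t j).
  { intros [|j] Hj; [lia|]. unfold p. destruct (Compare_dec.le_dec (S j) n); [easy|lia]. }
  assert (pn : p (S n) = v).
  { unfold p. destruct (Compare_dec.le_dec (S n) n); [lia|easy]. }
  assert (Ip : forall i, (i <= S n)%nat -> inside a b (p i)).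
  { intros i Hi. destruct (PeanoNat.Nat.eq_dec i 0) as [-> | N0]; [exact Iu|].
    destruct (PeanoNat.Nat.eq_dec i (S n)) as [-> | Nn]; [now rewrite pn|].
    rewrite pt by lia. apply It; lia. }
  assert (ps : forall i, (i <= n)%nat -> p i < s i < p (S i)).
  { intros i Hi. split.
    - destruct (PeanoNat.Nat.eq_dec i 0) as [-> | N0]; [exact us|].
      rewrite pt by lia. apply Hst; lia.
    - destruct (PeanoNat.Nat.eq_dec i n) as [-> | Nn]; [now rewrite pn|].
      rewrite pt by lia. destruct (Hst (S i) ltac:(lia)) as [H _].
      now replace (S i - 1)%nat with i in H by lia. }
  assert (Hsign : forall i, (i <= n)%nat -> forall x, p i < x < p (S i) ->
            0 < (-1) ^ i * f x).
  { intros i Hi.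
    assert (Hin : forall x, p i < x < p (S i) -> inside a b x).
    { intros x Hx. apply inside_between with (p i) (p (S i)); try (apply Ip; lia). lra. }
    apply (sign_constant f (fun x => p i < x < p (S i)) i (s i)).
    - intros; lra.
    - intros x Hx; apply Hc, Hin, Hx.
    (* A zero in the open piece would be some [t j] strictly between two consecutive breakpoints. *)
    - intros x Hx Ex. destruct (Hz x (Hin x Hx) Ex) as [j [Hj ->]].
      destruct (Compare_dec.le_lt_dec j i) as [Hji | Hji].
      + rewrite (pt i) in Hx by lia.
        destruct (PeanoNat.Nat.eq_dec j i) as [-> | Nji]; [lra|].
        assert (t j < t i) by (apply Hmono; lia). lra.
      + rewrite (pt (S i)) in Hx by lia.
        destruct (PeanoNat.Nat.eq_dec j (S i)) as [-> | Nji]; [lra|].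
        assert (t (S i) < t j) by (apply Hmono; lia). lra.
    - now apply ps.
    - now apply Hs. }
  assert (Hpiece : forall i, (i <= n)%nat ->
     is_RInt (fun x => Rabs (f x)) (p i) (p (S i)) ((-1) ^ i * (F (p (S i)) - F (p i)))).
  { intros i Hi.
    assert (Hin : forall x, p i <= x <= p (S i) -> inside a b x).
    { intros x Hx. apply inside_between with (p i) (p (S i)); try (apply Ip; lia). lra. }
    apply is_RInt_abs_derive_const_sign; auto.
    specialize (ps i Hi); lra. }
  assert (p0 : p 0%nat = u) by reflexivity.
  (* From here on [p] is known through [p0], [pt] and [pn]; [simpl] can no longer unfold it. *)
  clearbody p.
  assert (Hsum : forall m, (m <= n)%nat ->
     is_RInt (fun x => Rabs (f x)) u (p (S m))
       (- F u + 2 * sum_n_m (fun j => (-1) ^ (j + 1) * F (t j)) 1 m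
          + (-1) ^ m * F (p (S m)))).
  { induction m as [|m IH]; intros Hm.
    - generalize (Hpiece 0%nat Hm). rewrite p0, sum_n_m_zero, pow_O by lia.
      change (zero : R) with 0.
      match goal with |- is_RInt _ _ _ ?x -> is_RInt _ _ _ ?y =>
        now replace y with x by ring end.
    - generalize (is_RInt_Chasles _ _ _ _ _ _ (IH ltac:(lia)) (Hpiece (S m) Hm)).
      rewrite sum_n_Sm by lia. unfold plus; simpl.
      rewrite (pt (S m)) by lia.
      match goal with |- is_RInt _ _ _ ?x -> is_RInt _ _ _ ?y =>
        now replace y with x by (rewrite (pow_add (-1) m 1); simpl; ring) end. }
  generalize (Hsum n (PeanoNat.Nat.le_refl n)). now rewrite pn.
Qed.

(* [ring] and [field] do not see through the carriers of Coquelicot's structures. *)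
Ltac as_R_eq := match goal with |- ?x = ?y => change (@eq R x y) end.

(** * Polynomial functions: derivatives and growth *)

(** A closure of functions in place of lists of coefficients; [poly_ext] allows a change of form
    without functional extensionality. *)
Inductive polynomial : (R -> R) -> Prop :=
  | poly_const c : polynomial (fun _ => c)
  | poly_id : polynomial (fun x => x)
  | poly_plus p q : polynomial p -> polynomial q -> polynomial (fun x => p x + q x)
  | poly_mult p q : polynomial p -> polynomial q -> polynomial (fun x => p x * q x)
  | poly_ext p q : polynomial p -> (forall x, p x = q x) -> polynomial q.

Lemma polynomial_pow (p : R -> R) (k : nat) :
  polynomial p -> polynomial (fun x => p x ^ k).
Proof.
  intros Hp. induction k as [|k IH]; simpl.
  - apply poly_const.
  - now apply (poly_mult p (fun x => p x ^ k)).
Qed.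

Lemma polynomial_derive (p : R -> R) :
  polynomial p -> exists q, polynomial q /\ forall x, is_derive p x (q x).
Proof.
  induction 1 as [c | | p q Hp [p' [Pp' Dp]] Hq [q' [Pq' Dq]]
                 | p q Hp [p' [Pp' Dp]] Hq [q' [Pq' Dq]]
                 | p q Hp [p' [Pp' Dp]] Hpq].
  - exists (fun _ => 0); split; [apply poly_const | intros x; now auto_derive].
  - exists (fun _ => 1); split; [apply poly_const | intros x; now auto_derive].
  - exists (fun x => p' x + q' x); split; [now apply poly_plus|].
    intros x. now apply (is_derive_plus p q).
  - exists (fun x => p' x * q x + p x * q' x); split.
    + apply (poly_plus (fun x => p' x * q x) (fun x => p x * q' x)); now apply poly_mult.
    + intros x. apply (is_derive_mult p q); [easy | easy | exact Rmult_comm].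
  - exists p'; split; [exact Pp'|]. intros x. now apply (is_derive_ext p).
Qed.

Lemma polynomial_continuous (p : R -> R) (x : R) : polynomial p -> continuous p x.
Proof.
  intros Hp. destruct (polynomial_derive p Hp) as [q [_ Hq]].
  apply (ex_derive_continuous p). now exists (q x).
Qed.

(** Induction with [e] universally quantified, so that a product can spend [e / 2] on each factor.
    For the identity, [1 + y <= exp y] at [y = e * |x|] gives the constant [/ e]. *)
Lemma polynomial_exp_bound (p : R -> R) :
  polynomial p -> forall e, 0 < e ->
  exists C, 0 <= C /\ forall x, Rabs (p x) <= C * exp (e * Rabs x).
Proof.
  induction 1 as [c | | p q _ IHp _ IHq | p q _ IHp _ IHq
                 | p q _ IHp Hpq]; intros e He.
  - exists (Rabs c); split; [apply Rabs_pos|]. intros x.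
    assert (0 <= e * Rabs x) by (apply Rmult_le_pos; [lra | apply Rabs_pos]).
    pose proof (exp_ineq1_le (e * Rabs x)). pose proof (Rabs_pos c). nra.
  - exists (/ e); split; [left; now apply Rinv_0_lt_compat|]. intros x.
    apply (Rmult_le_reg_l e); [exact He|].
    replace (e * (/ e * exp (e * Rabs x))) with (exp (e * Rabs x)) by (field; lra).
    pose proof (exp_ineq1_le (e * Rabs x)). lra.
  - destruct (IHp e He) as [A [HA Bp]]. destruct (IHq e He) as [B [HB Bq]].
    exists (A + B); split; [lra|]. intros x.
    pose proof (Rabs_triang (p x) (q x)). specialize (Bp x). specialize (Bq x). lra.
  - destruct (IHp (e / 2) ltac:(lra)) as [A [HA Bp]].
    destruct (IHq (e / 2) ltac:(lra)) as [B [HB Bq]].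
    exists (A * B); split; [now apply Rmult_le_pos|]. intros x.
    rewrite Rabs_mult.
    replace (e * Rabs x) with (e / 2 * Rabs x + e / 2 * Rabs x) by field.
    rewrite exp_plus.
    replace (A * B * (exp (e / 2 * Rabs x) * exp (e / 2 * Rabs x)))
      with (A * exp (e / 2 * Rabs x) * (B * exp (e / 2 * Rabs x))) by ring.
    apply Rmult_le_compat; auto using Rabs_pos.
  - destruct (IHp e He) as [A [HA Bp]]. exists A; split; [exact HA|].
    intros x. rewrite <- Hpq. apply Bp.
Qed.

Lemma polynomial_affine (c d : R) : polynomial (fun x => c + d * x).
Proof.
  apply (poly_plus (fun _ => c) (fun x => d * x)); [apply poly_const|].
  apply (poly_mult (fun _ => d) (fun x => x)); [apply poly_const | apply poly_id].
Qed.

(** * Weights satisfying a Pearson equation, and the identity for them *)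

(** As [w' = w P / Q], differentiating [w Q^(m+1) p] costs one power of [Q] and leaves [w Q^m] times
    [P p + (m+1) Q' p + Q p']. *)
Lemma Derive_n_pearson (a b : Rbar) (w Q P : R -> R) (n : nat) :
  polynomial P -> polynomial Q ->
  (forall x, inside a b x -> 0 < Q x) ->
  (forall x, inside a b x -> is_derive w x (w x * P x / Q x)) ->
  forall k, (k <= n)%nat -> exists p, polynomial p /\
    forall x, inside a b x ->
      Derive_n (fun s => w s * Q s ^ n) k x = w x * Q x ^ (n - k) * p x.
Proof.
  intros HP HQ Qpos Hw.
  destruct (polynomial_derive Q HQ) as [Q' [PQ' DQ]].
  induction k as [|k IH]; intros Hk.
  - exists (fun _ => 1); split; [apply poly_const|].
    intros x _. rewrite PeanoNat.Nat.sub_0_r. simpl. ring.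
  - destruct (IH ltac:(lia)) as [p [Pp Ep]].
    destruct (polynomial_derive p Pp) as [p' [Pp' Dp]].
    set (m := (n - S k)%nat). replace (n - k)%nat with (S m) in Ep by lia.
    exists (fun x => (P x * p x + INR (S m) * (Q' x * p x)) + Q x * p' x); split.
    + apply (poly_plus (fun x => P x * p x + INR (S m) * (Q' x * p x)) (fun x => Q x * p' x));
        [|now apply poly_mult].
      apply (poly_plus (fun x => P x * p x) (fun x => INR (S m) * (Q' x * p x)));
        [now apply poly_mult|].
      apply (poly_mult (fun _ => INR (S m)) (fun x => Q' x * p x));
        [apply poly_const | now apply poly_mult].
    + intros x Ix. simpl Derive_n.
      (* The formula for order [k] holds only inside the interval; openness makes it a local
         equality, enough for the derivative. *)
      rewrite (Derive_ext_loc _ (fun x => w x * Q x ^ S m * p x)).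
      * apply is_derive_unique.
        assert (D : is_derive (fun x => w x * Q x ^ S m * p x) x
          ((w x * P x / Q x * Q x ^ S m + w x * (INR (S m) * Q' x * Q x ^ m)) * p x
            + w x * Q x ^ S m * p' x)).
        { apply (is_derive_mult (fun x => w x * Q x ^ S m) p); [|apply Dp | exact Rmult_comm].
          apply (is_derive_mult w (fun x => Q x ^ S m)); [now apply Hw | | exact Rmult_comm].
          exact (is_derive_pow Q (S m) x (Q' x) (DQ x)). }
        specialize (Qpos x Ix).
        match type of D with is_derive _ _ ?l => match goal with |- is_derive _ _ ?r =>
          replace r with l; [exact D|] end end.
        change (Q x ^ S m) with (Q x * Q x ^ m). field. lra.
      * apply (filter_imp (inside a b)); [exact Ep | now apply inside_locally].
Qed.

(** The common frame of the three families. The boundary hypotheses involve one factor [Q], because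
    each derivative of [w Q^n] of order below [n] still contains one. *)
Theorem L1_identity_pearson (a b : Rbar) (Fa Fb : (R -> Prop) -> Prop)
  {FFa : ProperFilter Fa} {FFb : ProperFilter Fb}
  (w Q P : R -> R) (mu : nat -> R) (n : nat) (x0 : R) :
  inside a b x0 ->
  reaches_left Fa (inside a b) -> reaches_right Fb (inside a b) ->
  polynomial P -> polynomial Q ->
  (forall x, inside a b x -> 0 < w x) ->
  (forall x, inside a b x -> 0 < Q x) ->
  (forall x, inside a b x -> is_derive w x (w x * P x / Q x)) ->
  (forall p, polynomial p -> filterlim (fun x => w x * Q x * p x) Fa (locally 0)) ->
  (forall p, polynomial p -> filterlim (fun x => w x * Q x * p x) Fb (locally 0)) ->
  (forall k, mu k <> 0) -> (1 <= n)%nat ->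
  L1_identity w Q mu a b Fa Fb n.
Proof.
  intros Ix0 HFa HFb HP HQ wpos Qpos Hw La Lb Hmu Hn t Ht Hz.
  set (g := fun s => w s * Q s ^ n).
  pose proof (Derive_n_pearson a b w Q P n HP HQ Qpos Hw) as Hform. fold g in Hform.
  assert (Hd : forall k x, (k <= n)%nat -> inside a b x -> ex_derive (Derive_n g k) x).
  { intros k x Hk Ix. destruct (Hform k Hk) as [p [Pp Ep]].
    destruct (polynomial_derive p Pp) as [p' [_ Dp]].
    destruct (polynomial_derive Q HQ) as [Q' [_ DQ]].
    apply (ex_derive_ext_loc (fun x => w x * Q x ^ (n - k) * p x)).
    - apply (filter_imp (inside a b)); [|now apply inside_locally].
      intros y Iy; symmetry; now apply Ep.
    - apply (ex_derive_mult (fun x => w x * Q x ^ (n - k)) p); [|now exists (p' x)].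
      apply (ex_derive_mult w (fun x => Q x ^ (n - k))).
      + eexists; now apply Hw.
      + apply ex_derive_pow. now exists (Q' x). }
  (* One factor [Q] is split off; the rest, [Q ^ (n - S k) * p], is again a polynomial. *)
  assert (Hlim : forall F, Filter F -> F (inside a b) ->
    (forall p, polynomial p -> filterlim (fun x => w x * Q x * p x) F (locally 0)) ->
    forall k, (k < n)%nat -> filterlim (Derive_n g k) F (locally 0)).
  { intros F FF HF L k Hk. destruct (Hform k ltac:(lia)) as [p [Pp Ep]].
    apply (filterlim_ext_loc (fun x => w x * Q x * (Q x ^ (n - S k) * p x))).
    - apply (filter_imp (inside a b)); [|exact HF].
      intros x Ix. rewrite (Ep x Ix). replace (n - k)%nat with (S (n - S k)) by lia.
      simpl. ring.
    - apply L, (poly_mult (fun x => Q x ^ (n - S k)) p); [|exact Pp].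
      now apply polynomial_pow. }
  assert (La' : forall k, (k < n)%nat -> filterlim (Derive_n g k) Fa (locally 0)).
  { apply Hlim; [apply FFa | | exact La].
    apply (filter_imp _ _ (fun x H => proj1 H) (HFa x0 Ix0)). }
  assert (Lb' : forall k, (k < n)%nat -> filterlim (Derive_n g k) Fb (locally 0)).
  { apply Hlim; [apply FFb | | exact Lb].
    apply (filter_imp _ _ (fun x H => proj1 H) (HFb x0 Ix0)). }
  assert (Hrod : forall x, inside a b x ->
            rodrigues w Q (mu n) n x = Derive_n g n x / (w x * mu n)).
  { intros x Ix. unfold rodrigues, g, Rdiv. apply Rmult_comm. }
  assert (Hz' : forall x, inside a b x -> Derive_n g n x = 0 ->
            exists j, (1 <= j <= n)%nat /\ x = t j).
  { intros x Ix E. apply Hz; [apply Ix | apply Ix |].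
    rewrite (Hrod x Ix), E. unfold Rdiv; ring. }
  destruct (alternation_Derive_n a b Fa Fb g n x0 HFa HFb Ix0) as [s [Hs Hinc]]; auto.
  { apply Rmult_lt_0_compat; [now apply wpos | apply pow_lt; now apply Qpos]. }
  { intros k x Hk; apply Hd; lia. }
  assert (Hcont : forall x, inside a b x -> continuous (Derive_n g n) x).
  { intros x Ix. apply (ex_derive_continuous (Derive_n g n)), Hd; [lia | exact Ix]. }
  pose proof (zeros_interlace a b (Derive_n g n) n s t Hcont Hs Hinc Ht Hz') as Hst.
  assert (It : forall j, (1 <= j <= n)%nat -> inside a b (t j)).
  { intros j Hj. apply inside_between with (s (j - 1)%nat) (s j);
      [apply Hs; lia | apply Hs; lia | specialize (Hst j Hj); lra]. }
  destruct n as [|n]; [lia|]. replace (S n - 1)%nat with n in * by lia.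
  set (F := Derive_n g n).
  set (S0 := sum_n_m (fun j => (-1) ^ (j + 1) * F (t j)) 1 (S n)).
  (* The degree is now [S n]. Since [(w Q) Q^n] is [g], each summand is its sign times
     [F (t j) / mu n], and [mu n] cancels. *)
  assert (Hval : 2 * (mu n / Rabs (mu (S n))) *
       sum_n_m (fun j => (-1) ^ (j + 1) * w (t j) * Q (t j) *
                 rodrigues (fun s => w s * Q s) Q (mu n) n (t j)) 1 (S n)
     = / Rabs (mu (S n)) * (2 * S0)).
  { transitivity (2 * (mu n / Rabs (mu (S n))) * (/ mu n * S0)).
    - f_equal. unfold S0. rewrite <- (sum_n_m_mult_l (/ mu n)).
      apply sum_n_m_ext_loc. intros j Hj. unfold rodrigues.
      rewrite (Derive_n_ext _ g) by (intros y; unfold g; simpl; ring).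
      fold F. change (mult (/ mu n) ?y) with (/ mu n * y).
      specialize (wpos _ (It j Hj)). specialize (Qpos _ (It j Hj)). specialize (Hmu n).
      as_R_eq. field. repeat split; lra || assumption.
    - field. split; [apply Rabs_no_R0, Hmu | apply Hmu]. }
  rewrite Hval. clear Hval.
  (* [V (u, v)] is the integral over [[u, v]]; its two boundary terms in [F] vanish in the limit. *)
  set (V := fun uv : R * R =>
    / Rabs (mu (S n)) * ((- F (fst uv) + 2 * S0) + (-1) ^ S n * F (snd uv))).
  assert (HV : filterlim V (filter_prod Fa Fb) (locally (/ Rabs (mu (S n)) * (2 * S0)))).
  { assert (L1 : filterlim (fun uv : R * R => F (fst uv)) (filter_prod Fa Fb) (locally 0)).
    { apply filterlim_comp with (1 := filterlim_fst). apply La'; lia. }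
    assert (L2 : filterlim (fun uv : R * R => F (snd uv)) (filter_prod Fa Fb) (locally 0)).
    { apply filterlim_comp with (1 := filterlim_snd). apply Lb'; lia. }
    apply (filterlim_Rmult (filter_prod Fa Fb)); [apply filterlim_const|].
    (* Negation is written as a factor [- 1], so that the product rule for limits covers it. *)
    replace (2 * S0) with ((- 1 * 0 + 2 * S0) + (-1) ^ S n * 0) by ring.
    apply (filterlim_ext (fun uv => (- 1 * F (fst uv) + 2 * S0) + (-1) ^ S n * F (snd uv))).
    { intros uv. as_R_eq. ring. }
    apply (filterlim_Rplus (filter_prod Fa Fb)); [apply (filterlim_Rplus (filter_prod Fa Fb))|];
      try apply filterlim_const; apply (filterlim_Rmult (filter_prod Fa Fb));
      apply filterlim_const || assumption. }
  intros A HA. unfold filtermapi.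
  (* Eventually [u] and [v] enclose all points [s i], as the formula on [[u, v]] requires. *)
  assert (Hprod : filter_prod Fa Fb (fun uv =>
      (inside a b (fst uv) /\ fst uv < s 0%nat) /\ (inside a b (snd uv) /\ s (S n) < snd uv))).
  { eapply Filter_prod.
    - apply (HFa (s 0%nat)), Hs; lia.
    - apply (HFb (s (S n))), Hs; lia.
    - intros x y Hx Hy; exact (conj Hx Hy). }
  generalize (filter_and _ (fun uv => A (V uv)) Hprod (HV A HA)). apply filter_imp.
  intros [u v] [[[Iu us] [Iv vs]] HAuv]. exists (V (u, v)); split; [|exact HAuv].
  simpl in Iu, us, Iv, vs |- *.
  apply (is_RInt_ext (fun x => scal (/ Rabs (mu (S n))) (Rabs (Derive_n g (S n) x)))).
  - intros x Hx.
    assert (uv : u < v).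
    { destruct (Hst 1%nat ltac:(lia)) as [H1 _].
      assert (s 0%nat <= s (S n)); [|lra].
      assert (forall i, (i <= S n)%nat -> s 0%nat <= s i) as Hle; [|apply Hle; lia].
      induction i as [|i IH]; intros Hi; [lra|].
      specialize (Hinc i Hi). specialize (IH ltac:(lia)). lra. }
    rewrite Rmin_left, Rmax_right in Hx by lra.
    assert (Ix : inside a b x) by (apply inside_between with u v; lra || assumption).
    specialize (wpos x Ix). rewrite (Hrod x Ix).
    change (scal ?c ?y) with (c * y). unfold Rdiv.
    rewrite Rabs_mult, Rabs_inv, Rabs_mult, (Rabs_pos_eq (w x)) by lra.
    as_R_eq. field. split; [apply Rabs_no_R0, Hmu | lra].
  - apply (is_RInt_scal (fun x => Rabs (Derive_n g (S n) x))).
    apply (is_RInt_abs_derive a b F _ (S n) s t); auto.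
    intros x Ix. exact (Derive_correct _ _ (Hd n x ltac:(lia) Ix)).
Qed.

(** * Filters at the ends of the intervals *)

Lemma reaches_left_at_right (a : R) (b : Rbar) : reaches_left (at_right a) (inside a b).
Proof.
  intros c [Ha Hb].
  unfold at_right, within.
  apply (filter_imp (fun x => x < c)); [|exact (open_lt c a Ha)].
  intros x Hx Hax. repeat split; [exact Hax | now apply Rbar_lt_trans with c | exact Hx].
Qed.

Lemma reaches_right_at_left (a : Rbar) (b : R) : reaches_right (at_left b) (inside a b).
Proof.
  intros c [Ha Hb].
  unfold at_left, within.
  apply (filter_imp (fun x => c < x)); [|exact (open_gt c b Hb)].
  intros x Hx Hxb. repeat split; [now apply Rbar_lt_trans with c | exact Hxb | exact Hx].
Qed.

Lemma reaches_left_m_infty (b : Rbar) :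
  reaches_left (Rbar_locally m_infty) (inside m_infty b).
Proof.
  intros c [Ha Hb]. exists c. intros x Hx.
  repeat split; [now apply Rbar_lt_trans with c | exact Hx].
Qed.

Lemma reaches_right_p_infty (a : Rbar) :
  reaches_right (Rbar_locally p_infty) (inside a p_infty).
Proof.
  intros c [Ha Hb]. exists c. intros x Hx.
  repeat split; [now apply Rbar_lt_trans with c | exact Hx].
Qed.

(** * Squeezing, exponential decay and real powers *)

Lemma filterlim_0_squeeze {T : Type} (F : (T -> Prop) -> Prop) {FF : Filter F}
  (f g : T -> R) :
  F (fun x => Rabs (f x) <= g x) -> filterlim g F (locally 0) ->
  filterlim f F (locally 0).
Proof.
  intros Hfg Hg. apply filterlim_locally. intros eps.
  generalize (filter_and _ _ Hfg (filterlim_0_lt F g eps Hg (cond_pos eps))).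
  apply filter_imp. intros x [H1 H2].
  change (Rabs (f x - 0) < eps). rewrite Rminus_0_r. lra.
Qed.

Lemma filterlim_0_mult {T : Type} (F : (T -> Prop) -> Prop) {FF : Filter F}
  (f u v : T -> R) (l : R) :
  F (fun x => u x * v x = f x) ->
  filterlim u F (locally 0) -> filterlim v F (locally l) ->
  filterlim f F (locally 0).
Proof.
  intros E Hu Hv. apply (filterlim_ext_loc _ _ E).
  replace 0 with (0 * l) by ring. now apply (filterlim_Rmult F).
Qed.

Lemma exp_decay_p_infty (C : R) :
  filterlim (fun x => C * exp (- (Rabs x / 2))) (Rbar_locally p_infty) (locally 0).
Proof.
  replace 0 with (C * 0) by ring.
  apply (filterlim_Rmult (Rbar_locally p_infty)); [apply filterlim_const|].
  intros A HA. destruct (is_lim_exp_m A HA) as [M HM].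
  exists (-2 * M). intros x Hx. apply HM. pose proof (Rle_abs x). lra.
Qed.

Lemma exp_decay_m_infty (C : R) :
  filterlim (fun x => C * exp (- (Rabs x / 2))) (Rbar_locally m_infty) (locally 0).
Proof.
  replace 0 with (C * 0) by ring.
  apply (filterlim_Rmult (Rbar_locally m_infty)); [apply filterlim_const|].
  intros A HA. destruct (is_lim_exp_m A HA) as [M HM].
  exists (2 * M). intros x Hx. apply HM. pose proof (Rle_abs (- x)).
  rewrite Rabs_Ropp in *. lra.
Qed.

Lemma filterlim_Rpower_0 (s : R) :
  0 < s -> filterlim (fun x => Rpower x s) (at_right 0) (locally 0).
Proof.
  intros Hs. unfold Rpower.
  apply (filterlim_comp _ _ _ ln (fun y => exp (s * y)) _ _ _ is_lim_ln_0).
  intros A HA. destruct (is_lim_exp_m A HA) as [M HM].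
  exists (M / s). intros y Hy. apply HM.
  apply (Rmult_lt_reg_r (/ s)); [now apply Rinv_0_lt_compat|].
  replace (s * y * / s) with y by (field; lra). exact Hy.
Qed.

Lemma Rpower_succ (x s : R) : 0 < x -> Rpower x s * x = Rpower x (s + 1).
Proof.
  intros Hx. rewrite Rpower_plus. now rewrite Rpower_1.
Qed.

Lemma exp_le_mono (x y : R) : x <= y -> exp x <= exp y.
Proof.
  intros [H | ->]; [left; now apply exp_increasing | apply Rle_refl].
Qed.

(** From [1 + y <= exp y] at [y = ln (d * x)]: [ln x <= d * x - ln d]. The free [d] makes the
    exponential rate as small as desired. *)
Lemma Rpower_le_exp (s d x : R) :
  0 < s -> 0 < d -> 0 < x -> Rpower x s <= exp (- (s * ln d)) * exp (s * d * x).
Proof.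
  intros Hs Hd Hx. rewrite <- exp_plus. apply exp_le_mono.
  pose proof (exp_ineq1_le (ln (d * x))) as H.
  rewrite exp_ln, ln_mult in H by (try apply Rmult_lt_0_compat; assumption).
  nra.
Qed.

Lemma continuous_at_right (f : R -> R) (a : R) :
  continuous f a -> filterlim f (at_right a) (locally (f a)).
Proof.
  intros H. exact (filterlim_filter_le_1 f (filter_le_within (F := locally a) _) H).
Qed.

Lemma continuous_at_left (f : R -> R) (b : R) :
  continuous f b -> filterlim f (at_left b) (locally (f b)).
Proof.
  intros H. exact (filterlim_filter_le_1 f (filter_le_within (F := locally b) _) H).
Qed.

(** * Boundary limits for the three families *)

(** The factor [Q] raises the exponent [al > -1] to [al + 1 > 0]; what remains is continuous at
    0. *)
Lemma laguerre_limit_0 (al : R) (p : R -> R) : -1 < al -> polynomial p ->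
  filterlim (fun x => lag_w al x * lag_Q x * p x) (at_right 0) (locally 0).
Proof.
  intros Hal Hp.
  apply (filterlim_0_mult (at_right 0) _ (fun x => Rpower x (al + 1))
           (fun x => exp (- x) * p x) (exp (- 0) * p 0)).
  - unfold at_right, within. apply filter_forall. intros x Hx. unfold lag_w, lag_Q.
    rewrite <- Rpower_succ by exact Hx. ring.
  - apply filterlim_Rpower_0; lra.
  - apply (continuous_at_right (fun x => exp (- x) * p x)).
    apply (continuous_mult (fun x => exp (- x)) p).
    + apply (ex_derive_continuous (fun x => exp (- x))). now auto_derive.
    + now apply polynomial_continuous.
Qed.

(** Of the decay [exp (- x)], a quarter of the exponent absorbs the power, a quarter the polynomial,
    and half is left. *)
Lemma laguerre_limit_infty (al : R) (p : R -> R) : -1 < al -> polynomial p ->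
  filterlim (fun x => lag_w al x * lag_Q x * p x) (Rbar_locally p_infty) (locally 0).
Proof.
  intros Hal Hp.
  destruct (polynomial_exp_bound p Hp (/ 4) ltac:(lra)) as [C [HC Bp]].
  (* Chosen so that [(al + 1) * d = / 4]. *)
  set (d := / (4 * (al + 1))).
  set (K := exp (- ((al + 1) * ln d))).
  apply (filterlim_0_squeeze (Rbar_locally p_infty) _
           (fun x => K * C * exp (- (Rabs x / 2)))); [|apply exp_decay_p_infty].
  exists 0. intros x Hx. unfold lag_w, lag_Q.
  assert (Hd : 0 < d) by (apply Rinv_0_lt_compat; lra).
  pose proof (Rpower_le_exp (al + 1) d x ltac:(lra) Hd Hx) as H. fold K in H.
  replace ((al + 1) * d) with (/ 4) in H by (unfold d; field; lra).
  specialize (Bp x). rewrite (Rabs_pos_eq x) in * by lra.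
  replace (Rpower x al * exp (- x) * x) with (Rpower x (al + 1) * exp (- x))
    by (rewrite <- Rpower_succ by exact Hx; ring).
  rewrite !Rabs_mult, (Rabs_pos_eq (Rpower _ _)), (Rabs_pos_eq (exp (- x)))
    by (left; apply exp_pos).
  replace (- (x / 2)) with (/ 4 * x + (- x) + / 4 * x) by field.
  rewrite !exp_plus.
  replace (K * C * (exp (/ 4 * x) * exp (- x) * exp (/ 4 * x)))
    with (K * exp (/ 4 * x) * exp (- x) * (C * exp (/ 4 * x))) by ring.
  apply Rmult_le_compat; [| apply Rabs_pos | | exact Bp].
  - apply Rmult_le_pos; left; apply exp_pos.
  - apply Rmult_le_compat_r; [left; apply exp_pos | exact H].
Qed.

Lemma hermite_bound (p : R -> R) : polynomial p -> exists C, forall x,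
  Rabs (her_w x * her_Q x * p x) <= C * exp (- (Rabs x / 2)).
Proof.
  intros Hp. destruct (polynomial_exp_bound p Hp 1 ltac:(lra)) as [C [HC Bp]].
  exists (C * exp 1). intros x. unfold her_w, her_Q.
  rewrite Rmult_1_r, Rabs_mult, (Rabs_pos_eq (exp _)) by (left; apply exp_pos).
  apply Rle_trans with (exp (- x ^ 2) * (C * exp (1 * Rabs x))).
  - apply Rmult_le_compat_l; [left; apply exp_pos | apply Bp].
  - replace (exp (- x ^ 2) * (C * exp (1 * Rabs x)))
      with (C * exp (- x ^ 2 + 1 * Rabs x)) by (rewrite exp_plus; ring).
    rewrite Rmult_assoc, <- exp_plus.
    apply Rmult_le_compat_l; [exact HC|]. apply exp_le_mono.
    (* The square yields [- x^2 + |x| <= 9/16 - |x| / 2], and [9/16 <= 1]. *)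
    rewrite <- pow2_abs. pose proof (pow2_ge_0 (Rabs x - 3 / 4)). lra.
Qed.

(** As [1 - x^2 = (1 - x) (1 + x)], the factor [Q] raises both exponents by one. *)
Lemma jacobi_factor (al be x : R) (p : R -> R) : -1 < x < 1 ->
  Rpower (1 + x) (be + 1) * (Rpower (1 - x) (al + 1) * p x)
    = jac_w al be x * jac_Q x * p x.
Proof.
  intros Hx. rewrite <- !Rpower_succ by lra. unfold jac_w, jac_Q. ring.
Qed.

(** [(1 + x)^(be + 1)] has a positive exponent and tends to 0, while the other factors are
    continuous at [-1], where [1 - x = 2]. *)
Lemma jacobi_limit_left (al be : R) (p : R -> R) : -1 < be -> polynomial p ->
  filterlim (fun x => jac_w al be x * jac_Q x * p x) (at_right (-1)) (locally 0).
Proof.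
  intros Hbe Hp.
  apply (filterlim_0_mult (at_right (-1)) _ (fun x => Rpower (1 + x) (be + 1))
           (fun x => Rpower (1 - x) (al + 1) * p x) (Rpower (1 - -1) (al + 1) * p (-1))).
  - unfold at_right, within. apply (filter_imp (fun x => x < 1)); [|apply (open_lt 1); lra].
    intros x H1 H2. now apply jacobi_factor.
  - apply (filterlim_comp _ _ _ (fun x => 1 + x) (fun y => Rpower y (be + 1)) _ (at_right 0));
      [|apply filterlim_Rpower_0; lra].
    intros A [e He]. exists e. intros y Hy Hy'. apply He; [|lra].
    change (Rabs (1 + y - 0) < e). change (Rabs (y - -1) < e) in Hy.
    now replace (1 + y - 0) with (y - -1) by ring.
  - apply (continuous_at_right (fun x => Rpower (1 - x) (al + 1) * p x)).
    apply (continuous_mult (fun x => Rpower (1 - x) (al + 1)) p).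
    + apply (ex_derive_continuous (fun x => Rpower (1 - x) (al + 1))).
      unfold Rpower. auto_derive. lra.
    + now apply polynomial_continuous.
Qed.

Lemma jacobi_limit_right (al be : R) (p : R -> R) : -1 < al -> polynomial p ->
  filterlim (fun x => jac_w al be x * jac_Q x * p x) (at_left 1) (locally 0).
Proof.
  intros Hal Hp.
  apply (filterlim_0_mult (at_left 1) _ (fun x => Rpower (1 - x) (al + 1))
           (fun x => Rpower (1 + x) (be + 1) * p x) (Rpower (1 + 1) (be + 1) * p 1)).
  - unfold at_left, within. apply (filter_imp (fun x => -1 < x)); [|apply (open_gt (-1)); lra].
    intros x H1 H2. rewrite <- jacobi_factor by easy. ring.
  (* The reflection [x -> 1 - x] carries the left of 1 to the right of 0, keeping the radius [e]. *)
  - apply (filterlim_comp _ _ _ (fun x => 1 - x) (fun y => Rpower y (al + 1)) _ (at_right 0));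
      [|apply filterlim_Rpower_0; lra].
    intros A [e He]. exists e. intros y Hy Hy'. apply He; [|lra].
    change (Rabs (1 - y - 0) < e). change (Rabs (y - 1) < e) in Hy.
    rewrite Rabs_minus_sym in Hy. now rewrite Rminus_0_r.
  - apply (continuous_at_left (fun x => Rpower (1 + x) (be + 1) * p x)).
    apply (continuous_mult (fun x => Rpower (1 + x) (be + 1)) p).
    + apply (ex_derive_continuous (fun x => Rpower (1 + x) (be + 1))).
      unfold Rpower. auto_derive. lra.
    + now apply polynomial_continuous.
Qed.

(** * The Laguerre, Hermite and Jacobi data *)

Theorem theorem1p1 :
  (* Laguerre, (a,b) = (0, +oo), alpha > -1 *)
  (forall (al : R), -1 < al -> forall n : nat, (1 <= n)%nat ->
     L1_identity (lag_w al) lag_Q lag_mu (Finite 0) p_infty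
       (at_right 0) (Rbar_locally p_infty) n) /\
  (* Hermite, (a,b) = (-oo, +oo) *)
  (forall n : nat, (1 <= n)%nat ->
     L1_identity her_w her_Q her_mu m_infty p_infty
       (Rbar_locally m_infty) (Rbar_locally p_infty) n) /\
  (* Jacobi, (a,b) = (-1, 1), alpha, beta > -1 *)
  (forall (al be : R), -1 < al -> -1 < be -> forall n : nat, (1 <= n)%nat ->
     L1_identity (jac_w al be) jac_Q jac_mu (Finite (-1)) (Finite 1)
       (at_right (-1)) (at_left 1) n).
Proof.
  split; [|split].
  - intros al Hal n Hn.
    (* [w' / w = al / x - 1 = (al - x) / x]; the last argument is a sample point of the interval. *)
    apply (L1_identity_pearson 0 p_infty _ _ (lag_w al) lag_Q
             (fun x => al + -1 * x) lag_mu n 1); try assumption.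
    + split; simpl; lra || easy.
    + apply reaches_left_at_right.
    + apply reaches_right_p_infty.
    + apply polynomial_affine.
    + apply poly_id.
    (* [Rpower] is by definition an exponential, hence positive at every argument. *)
    + intros x _. apply Rmult_lt_0_compat; apply exp_pos.
    + intros x [Hx _]. exact Hx.
    + intros x [Hx _]. simpl in Hx. unfold lag_w, lag_Q, Rpower.
      auto_derive; [exact Hx | field; lra].
    + intros p; now apply laguerre_limit_0.
    + intros p; now apply laguerre_limit_infty.
    + apply INR_fact_neq_0.
  - intros n Hn.
    apply (L1_identity_pearson m_infty p_infty _ _ her_w her_Q
             (fun x => 0 + -2 * x) her_mu n 0); try assumption.
    + split; easy.
    + apply reaches_left_m_infty.
    + apply reaches_right_p_infty.
    + apply polynomial_affine.
    + exact (poly_const 1).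
    + intros x _. apply exp_pos.
    + intros x _. apply Rlt_0_1.
    + intros x _. unfold her_w, her_Q. auto_derive; [easy | simpl; field].
    + intros p Hp. destruct (hermite_bound p Hp) as [C HC].
      apply (filterlim_0_squeeze _ _ _ (filter_forall _ HC)), exp_decay_m_infty.
    + intros p Hp. destruct (hermite_bound p Hp) as [C HC].
      apply (filterlim_0_squeeze _ _ _ (filter_forall _ HC)), exp_decay_p_infty.
    + apply pow_m1_neq0.
  - intros al be Hal Hbe n Hn.
    (* [P] is the numerator of [w' / w = - al / (1 - x) + be / (1 + x)] over [1 - x^2]. *)
    apply (L1_identity_pearson (-1) 1 _ _ (jac_w al be) jac_Q
             (fun x => (be - al) + - (al + be) * x) jac_mu n 0); try assumption.
    + split; simpl; lra.
    + apply reaches_left_at_right.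
    + apply reaches_right_at_left.
    + apply polynomial_affine.
    + apply (poly_ext (fun x => (1 + -1 * x) * (1 + 1 * x))).
      * apply (poly_mult (fun x => 1 + -1 * x) (fun x => 1 + 1 * x)); apply polynomial_affine.
      * intros x. unfold jac_Q. ring.
    + intros x _. apply Rmult_lt_0_compat; apply exp_pos.
    + intros x [H1 H2]. simpl in H1, H2. unfold jac_Q. nra.
    + intros x [H1 H2]. simpl in H1, H2. unfold jac_w, jac_Q, Rpower.
      auto_derive; [split; [lra | split; [lra | easy]] |].
      change (1 + - x) with (1 - x). field. repeat split; nra.
    + intros p; now apply jacobi_limit_left.
    + intros p; now apply jacobi_limit_right.
    + intros k. unfold jac_mu. repeat apply Rmult_integral_contrapositive_currified.
      * apply pow_m1_neq0.
      * apply pow_nonzero; lra.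
      * apply INR_fact_neq_0.
Qed.
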